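(* Let $X,Z$ be Banach spaces, $Q\subset Z$ a closed convex pointed cone, and $G:X\rightrightarrows Z$ a closed-graph multifunction. Suppose that $(\overline{x},\overline{q},\overline{z})\in X\times Z\times Z$ is such that $\overline{z}\in G(\overline{x})+\overline{q}$ and $\overline{q}\in Q$. Let $m>0$ be given. If there exist a neighborhood $U\times V$ of $(\overline{x},\overline{q})$ and a real $\gamma>0$ such that $$|\nabla\varphi_{\mathcal{E}_G}((\cdot,\cdot),\overline{z})|(x,q)\geq m\quad\text{for all }(x,q)\in U\times V\text{ with }\varphi_{\mathcal{E}_G}((x,q),\overline{z})\in(0,\gamma),$$ then there exists a neighborhood $\tilde{U}\times\tilde{V}$ of $(\overline{x},\overline{q})$ such that $$d((x,q),\mathcal{E}_G^{-1}(\overline{z}))\leq\frac{1}{m}\,d(\overline{z},G(x)+q)\quad\text{for all }(x,q)\in\tilde{U}\times[\tilde{V}\cap Q].$$ In other words, $\mathcal{E}_G$ is metrically subregular at $((\overline{x},\overline{q}),\overline{z})$, hence $\mathcal{E}_G$ is linearly pseudo-open at $((\overline{x},\overline{q}),\overline{z})$.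
   Context: $d(x,A)=\inf_{a\in A}d(x,a)$ with $d(x,\emptyset)=\infty$; product spaces carry the additive (sum) norm; $B(x,r)$ is the open ball. The map $\mathcal{E}_G:X\times Z\rightrightarrows Z$ is given by $\mathcal{E}_G(x,q)=G(x)+q$ if $q\in Q$ and $\mathcal{E}_G(x,q)=\emptyset$ otherwise; $\mathcal{E}_G^{-1}(z)=\{(x,q)\mid q\in Q,\ z\in G(x)+q\}$. The lower semicontinuous function $\varphi_{\mathcal{E}_G}:X\times Z\times Z\rightarrow\mathbb{R}\cup\{+\infty\}$ is $$\varphi_{\mathcal{E}_G}((x,q),z):=\liminf_{(u,r,v)\rightarrow(x,q,z)}d(v,\mathcal{E}_G(u,r)),$$ which equals $\liminf_{u\rightarrow x}d(z,G(u)+q)$ if $q\in Q$ and $+\infty$ otherwise. The strong slope of a lower semicontinuous function $f$ at $x$ with $f(x)<+\infty$ is $|\nabla f|(x)=0$ if $x$ is a local minimum of $f$, and $|\nabla f|(x)=\limsup_{y\rightarrow x,\,y\neq x}\frac{f(x)-f(y)}{d(x,y)}$ otherwise; if $f(x)=+\infty$, $|\nabla f|(x)=+\infty$. Here $|\nabla\varphi_{\mathcal{E}_G}((\cdot,\cdot),\overline{z})|(x,q)$ is the strong slope at $(x,q)$ of the function $(x,q)\mapsto\varphi_{\mathcal{E}_G}((x,q),\overline{z})$ on $X\times Z$. A multifunction $F:X\rightrightarrows Y$ is metrically subregular at $(\overline{x},\overline{y})\in\operatorname{Gr}F$ if there are $L>0$ and a neighborhood $U$ of $\overline{x}$ with $d(x,F^{-1}(\overline{y}))\leq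 L\,d(\overline{y},F(x))$ for every $x\in U$. $F$ is linearly pseudo-open at $(\overline{x},\overline{y})$ if there exist $L>0$, a neighborhood $U$ of $\overline{x}$ and $\varepsilon>0$ such that for every $\rho\in(0,\varepsilon)$ and every $x\in U\cap F^{-1}(B(\overline{y},L\rho))$ one has $\overline{y}\in F(B(x,\rho))$. *)

(* Defs.v *)
From HB Require Import structures.
From mathcomp Require Import all_boot all_order all_algebra.
From mathcomp Require Import all_classical all_reals all_analysis.

Set Implicit Arguments.
Unset Strict Implicit.
Unset Printing Implicit Defensive.

Import Order.TTheory GRing.Theory Num.Theory.
Import numFieldNormedType.Exports.

Local Open Scope classical_set_scope.
Local Open Scope ring_scope.

(* The norm that MathComp-Analysis puts on X * Z is the max norm, whereas
   product spaces carry the sum norm here.  The metric notions below therefore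
   take the distance as an explicit argument; neighbourhoods come from the
   topology, which both norms on X * Z induce (see nbhs_sum_distP). *)

Section Distances.
Context {R : realType}.

Definition norm_dist (Z : normedModType R) (x y : Z) : R := `|x - y|.

Definition sum_dist (X Z : normedModType R) (p p' : X * Z) : R :=
  norm_dist p.1 p'.1 + norm_dist p.2 p'.2.

Lemma nbhs_sum_distP (X Z : normedModType R) (p : X * Z) (A : set (X * Z)) :
  nbhs p A <->
  exists2 e : R, 0 < e & forall p', sum_dist p p' < e -> A p'.
Proof.
split=> [/nbhs_ballP [e /= e0 eA]|[e e0 eA]].
  exists e => // p' pp'; apply: eA; split; rewrite -ball_normE /=;
    apply: le_lt_trans pp'; rewrite /sum_dist /norm_dist.
    by rewrite lerDl.
  by rewrite lerDr.
apply/nbhs_ballP; exists (e / 2); first exact: divr_gt0.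
move=> p' []; rewrite -!ball_normE /= => h1 h2.
by apply: eA; rewrite (splitr e); exact: ltrD.
Qed.

(* ereal_inf set0 = +oo *)
Definition dist_set (T : Type) (dist : T -> T -> R) (x : T) (A : set T) :
  \bar R := ereal_inf [set (dist x a)%:E | a in A].

Definition dist_ball (T : Type) (dist : T -> T -> R) (x : T) (r : R) : set T :=
  [set y | dist x y < r].

End Distances.

Section Multifunctions.
Context {X Y : Type}.
Implicit Types F : X -> set Y.

Definition graph F : set (X * Y) := [set p | F p.1 p.2].

Definition mf_inv F (y : Y) : set X := [set x | F x y].

Definition mf_preimage F (B : set Y) : set X := [set x | F x `&` B !=set0].

Definition mf_image F (A : set X) : set Y := \bigcup_(x in A) F x.

End Multifunctions.

Section Cones.
Context {R : realType} {Z : normedModType R}.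
Implicit Types Q : set Z.

Definition cone Q : Prop :=
  Q !=set0 /\ forall (t : R) (z : Z), 0 <= t -> Q z -> Q (t *: z).

Definition pointed_cone Q : Prop :=
  cone Q /\ Q `&` [set - z | z in Q] = [set 0].

End Cones.

Section StrongSlope.
Context {R : realType} {T : topologicalType}.
Local Open Scope ereal_scope.

Definition local_min (f : T -> \bar R) (x : T) : Prop :=
  \forall y \near x, f x <= f y.

Definition strong_slope (dist : T -> T -> R) (f : T -> \bar R) (x : T) :
    \bar R :=
  if f x == +oo then +oo
  else if `[< local_min f x >] then 0
  else limf_esup (fun y => (f x - f y) * ((dist x y)^-1)%:E) x^'.

End StrongSlope.

Section Regularity.
Context {R : realType} {S T : topologicalType}.
Variables (dS : S -> S -> R) (dT : T -> T -> R).

Definition metrically_subregular (F : S -> set T) (x0 : S) (y0 : T) : Prop :=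
  graph F (x0, y0) /\
  exists2 L : R, 0 < L &
    exists2 U : set S, nbhs x0 U &
      forall x, U x ->
        (dist_set dS x (mf_inv F y0) <= L%:E * dist_set dT y0 (F x))%E.

Definition linearly_pseudo_open (F : S -> set T) (x0 : S) (y0 : T) : Prop :=
  graph F (x0, y0) /\
  exists L : R, exists U : set S, exists eps : R,
    [/\ 0 < L, nbhs x0 U, 0 < eps &
      forall (rho : R) (x : S), 0 < rho < eps ->
        (U `&` mf_preimage F (dist_ball dT y0 (L * rho))) x ->
        mf_image F (dist_ball dS x rho) y0].

End Regularity.

Section EpigraphicalMap.
Context {R : realType} {X Z : normedModType R}.

Definition translate (A : set Z) (q : Z) : set Z := [set a + q | a in A].

Definition epi_map (Q : set Z) (G : X -> set Z) (p : X * Z) : set Z :=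
  if p.2 \in Q then translate (G p.1) p.2 else set0.

(* The limit inferior is the non-punctured one (the point itself is allowed),
   so that this is the lower semicontinuous envelope. *)
Definition phi_epi (Q : set Z) (G : X -> set Z) (p : X * Z) (z : Z) : \bar R :=
  limf_einf
    (fun w : (X * Z) * Z => dist_set (@norm_dist R Z) w.2 (epi_map Q G w.1))
    (nbhs (p, z)).

End EpigraphicalMap.

(* Main.v *)
(* By closedness of Q and of the graph of G, the zeros of f = phi(., z0) are the
   points of E_G^{-1}(z0), and f <= d(z0, E_G(.)), so it suffices to bound the
   distance to the zero set of f by f / m near (x0, q0).  If this failed at p,
   Ekeland's variational principle started at p would give a point u where the
   slope of f is less than m, whose distance to p is less than the distance of
   p to the zero set.  Then f(u) > 0, and since (x0, q0) is itself a zero, u is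
   close to (x0, q0), against the hypothesis on the slope. *)
Require Import Defs.
From HB Require Import structures.
From mathcomp Require Import all_boot all_order all_algebra.
From mathcomp Require Import all_classical all_reals all_analysis.
From mathcomp Require Import lra.

Set Implicit Arguments.
Unset Strict Implicit.
Unset Printing Implicit Defensive.

Import Order.TTheory GRing.Theory Num.Theory.
Import numFieldNormedType.Exports.

Local Open Scope classical_set_scope.
Local Open Scope ring_scope.

(** * Ekeland's variational principle and the error bound drawn from slopes *)

Section Ekeland.
Context {R : realType}.
Local Open Scope ereal_scope.

(** The distance is a parameter, independent of any topology on [T]. Comparing the tail with the
    single term [u N] is equivalent to the usual Cauchy condition by the triangle inequality. *)
Record complete_metric (T : Type) (d : T -> T -> R) : Prop := CompleteMetric {
  cm_refl : forall x, d x x = 0%R;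
  cm_eq0 : forall x y, d x y = 0%R -> x = y;
  cm_ge0 : forall x y, (0 <= d x y)%R;
  cm_sym : forall x y, d x y = d y x;
  cm_triangle : forall x y z, (d x z <= d x y + d y z)%R;
  cm_complete : forall u : nat -> T,
    (forall e, (0 < e)%R ->
       exists N, forall n, (N <= n)%N -> (d (u N) (u n) < e)%R) ->
    exists l, forall e, (0 < e)%R -> \forall n \near \oo, (d (u n) l < e)%R }.

Definition dist_lsc (T : Type) (d : T -> T -> R) (f : T -> \bar R) : Prop :=
  forall x a, a < f x -> exists2 e, (0 < e)%R & forall y, (d x y < e)%R -> a < f y.

Lemma ge0_lt_pinfty_EFin (x : \bar R) : 0 <= x -> x < +oo ->
  exists2 r : R, (0 <= r)%R & x = r%:E.
Proof. by case: x => [r| |] // r0 _; exists r. Qed.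

(** Sections of the preorder [S] are nested. A sequence whose next term nearly minimises [f] over
    the current section makes them shrink to one point; that limit lies in all of them and has only
    itself below it. *)
Lemma ekeland (T : Type) (d : T -> T -> R) (dP : complete_metric d)
    (f : T -> \bar R) (f_lsc : dist_lsc d f) (f_ge0 : forall x, 0 <= f x)
    (k : R) (k_gt0 : (0 < k)%R) (p : T) (fp_fin : f p < +oo) :
  exists2 u, f u + (k * d p u)%:E <= f p &
    forall v, v <> u -> f u < f v + (k * d u v)%:E.
Proof.
pose S x v := f v + (k * d x v)%:E <= f x.
have kd_ge0 x y : (0 <= k * d x y)%R by rewrite mulr_ge0 ?(cm_ge0 dP) // ltW.
have S_le x v : S x v -> f v <= f x.
  by apply: le_trans; rewrite leeDl // lee_fin.
have S_refl x : S x x by rewrite /S (cm_refl dP) mulr0 adde0.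
have S_trans y x z : S x y -> S y z -> S x z.
  rewrite /S => Sxy Syz; apply: le_trans Sxy.
  apply: le_trans (leeD2r _ Syz); rewrite -addeA leeD2l // -EFinD lee_fin.
  by rewrite -mulrDr ler_pM2l // addrC (cm_triangle dP).
(* Finiteness of [f x] sits under the existential so that [choice] yields a total function. *)
have step (n : nat) x : exists v, f x < +oo -> S x v /\
    forall w, S x w -> f v <= f w + (n.+1%:R^-1)%:E.
  have [fx|_] := boolP (f x < +oo); last by exists x.
  have inf_fin : ereal_inf [set f w | w in S x] \is a fin_num.
    rewrite ge0_fin_numE; last by apply/ereal_infP => _ [w _ <-].
    by apply: le_lt_trans fx; apply: ereal_inf_lbound; exists x.
  have n0 : (0 < n.+1%:R^-1 :> R)%R by rewrite invr_gt0.
  have [_ [v Sxv <-] fv] := lb_ereal_inf_adherent n0 inf_fin.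
  exists v => _; split=> // w Sxw; apply/ltW/(lt_le_trans fv).
  by rewrite leeD2r //; apply: ereal_inf_lbound; exists w.
have [next nextP] := choice (fun nx : nat * T => step nx.1 nx.2).
pose u := fix u n := if n is n'.+1 then next (n', u n') else p.
have u_fin n : f (u n) < +oo.
  elim: n => // n IH; apply: le_lt_trans (IH).
  by apply: S_le; exact: (nextP (n, u n) IH).1.
have S_mono i j : (i <= j)%N -> S (u i) (u j).
  move=> /subnK <-; elim: (j - i)%N => // n IH.
  by apply: (S_trans _ _ _ IH); exact: (nextP ((n + i)%N, u _) (u_fin _)).1.
(* Near-minimality gives [f (u n.+1) <= f w + 1/(n+1)], while [S (u n.+1) w] gives
   [f w + k d <= f (u n.+1)]; cancelling the finite [f w] bounds the distance. *)
have S_small n w : S (u n) w -> S (u n.+1) w ->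
    (k * d (u n.+1) w <= n.+1%:R^-1)%R.
  move=> /(nextP (n, u n) (u_fin _)).2 /= le1; rewrite /S /= => le2.
  have := le_trans le2 le1.
  have fw : f w < +oo.
    apply: le_lt_trans (u_fin n.+1).
    by exact: S_le.
  have [r _ ->] := ge0_lt_pinfty_EFin (f_ge0 w) fw.
  by rewrite -!EFinD lee_fin lerD2l.
have inv_lt (e : R) : (0 < e)%R -> exists n : nat, (n.+1%:R^-1 < k * e)%R.
  move=> e0; have ke0 : (0 < k * e)%R by rewrite mulr_gt0.
  have [n _ nP] := near_infty_natSinv_lt (PosNum ke0).
  by exists n; exact: nP n (leqnn n).
have [l ul] : exists l, forall e, (0 < e)%R ->
    \forall n \near \oo, (d (u n) l < e)%R.
  apply: (cm_complete dP) => e /inv_lt[n ne]; exists n.+1 => j nj.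
  rewrite -(ltr_pM2l k_gt0); apply: le_lt_trans ne.
  by apply: S_small; apply: S_mono => //; exact: ltnW.
have S_lim n : S (u n) l.
  have [r _ fr] := ge0_lt_pinfty_EFin (f_ge0 (u n)) (u_fin n).
  (* If [f l] exceeded [f (u n) - k d (u n) l] by more than [e], lower semicontinuity would pass
     this to [f (u j)] for large [j], against [S (u n) (u j)] once [d (u j) l < e / k]. *)
  rewrite /S fr -leeBrDr // -EFinB; apply/lee_addgt0Pr => e e0.
  rewrite leNgt; apply/negP; rewrite -EFinD => /f_lsc[e' e'0 lt_f].
  have ek0 : (0 < e / k)%R by rewrite divr_gt0.
  have [N1 _ N1P] := ul _ e'0; have [N2 _ N2P] := ul _ ek0.
  pose j := maxn n (maxn N1 N2).
  have {lt_f}: (r - k * d (u n) l + e)%:E < f (u j).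
    by apply: lt_f; rewrite (cm_sym dP); apply: N1P; rewrite /= !leq_max leqnn orbT.
  have := S_mono n j (leq_maxl _ _); rewrite /S fr.
  have [s _ ->] := ge0_lt_pinfty_EFin (f_ge0 (u j)) (u_fin j).
  rewrite -EFinD lee_fin lte_fin => sr rs.
  have ujl : (k * d (u j) l < e)%R.
    rewrite mulrC -ltr_pdivlMr //; apply: N2P.
    by rewrite /= !leq_max leqnn !orbT.
  have : (k * d (u n) l <= k * d (u n) (u j) + k * d (u j) l)%R.
    by rewrite -mulrDr ler_pM2l // (cm_triangle dP).
  lra.
exists l; first exact: (S_lim 0%N).
move=> v vl; rewrite ltNge; apply/negP => Slv; apply: vl.
apply/(cm_eq0 dP)/eqP; rewrite eq_le (cm_ge0 dP) andbT.
apply/ler_addgt0Pr => e e0; rewrite add0r.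
have e20 : (0 < e / 2)%R by rewrite divr_gt0.
have [n ne] := inv_lt _ e20.
(* Both [l] and any [v] below it lie in the small section of [u n.+1], hence are within [e] of each
   other. *)
have near_u w : S l w -> (d (u n.+1) w < e / 2)%R.
  move=> Slw; rewrite -(ltr_pM2l k_gt0); apply: le_lt_trans ne.
  by apply: S_small; exact: S_trans (S_lim _) Slw.
apply: le_trans (cm_triangle dP v (u n.+1) l) _.
by rewrite (cm_sym dP v) [leRHS]splitr; apply: lerD; apply: ltW; apply: near_u.
Qed.

(** The assumption bounds every difference quotient by [k] on the whole punctured space, which is
    itself a punctured neighbourhood of [x], so the limsup is at most [k]. *)
Lemma strong_slope_le (T : topologicalType) (d : T -> T -> R)
    (d_gt0 : forall x y, x <> y -> (0 < d x y)%R)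
    (f : T -> \bar R) (x : T) (k : R) :
  (0 <= k)%R -> f x \is a fin_num ->
  (forall v, v <> x -> f x <= f v + (k * d x v)%:E) ->
  strong_slope d f x <= k%:E.
Proof.
move=> k0 fx le_f; rewrite /strong_slope; case: eqP => [fxoo|_].
  by rewrite fxoo in fx.
case: ifP => _; first by rewrite lee_fin.
apply: ge_ereal_inf; exists (ereal_sup
  [set (f x - f y) * ((d x y)^-1)%:E | y in [set y | y != x]]).
  by exists [set y | y != x] => //; rewrite /dnbhs /within /=; apply: nearW.
apply/ereal_supP => _ [v /= /eqP vx <-].
rewrite lee_pdivrMr; last by apply: d_gt0 => /esym.
move: fx (le_f v vx); case: (f x) => // r _; case: (f v) => [s| |] //.
  by rewrite -EFinD -EFinB -EFinM !lee_fin => h; lra.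
by rewrite /= leNye.
Qed.

(* A strict failure [dist_set d p S > f p / m], with [S] the zero set, persists
   for some [k < m], and Ekeland's principle is applied with this [k]. *)
Lemma slope_error_bound (T : topologicalType) (d : T -> T -> R)
    (dP : complete_metric d) (f : T -> \bar R) (f_lsc : dist_lsc d f)
    (f_ge0 : forall x, 0 <= f x) (x0 : T) (fx0 : f x0 = 0)
    (m delta gamma : R) :
  (0 < m)%R -> (0 < delta)%R -> (0 < gamma)%R ->
  (forall x, (d x0 x < delta)%R -> 0 < f x < gamma%:E ->
     m%:E <= strong_slope d f x) ->
  exists2 e : R, (0 < e)%R & forall x, (d x0 x < e)%R ->
    dist_set d x [set y | f y = 0] <= (1 / m)%:E * f x.
Proof.
move=> m0 delta0 gamma0 slope.
have d_gt0 x y : x <> y -> (0 < d x y)%R.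
  by move=> xy; rewrite lt0r (cm_ge0 dP) andbT; apply/eqP => /(cm_eq0 dP).
(* With [c] the distance from [p] to the zero set, [c <= d x0 p]. The first bound keeps [u], closer
   than [c] to [p], within [delta] of [x0]; the second gives [f u <= f p < c * m < gamma]. *)
exists (Num.min (delta / 2) (gamma / m))%R.
  by rewrite lt_min !divr_gt0.
move=> p; rewrite lt_min => /andP[p_delta p_gamma].
rewrite leNgt; apply/negP => far.
have dist_le y : f y = 0 -> dist_set d p [set y | f y = 0] <= (d p y)%:E.
  by move=> fy; apply: ereal_inf_lbound; exists y.
have far0 := dist_le _ fx0.
have fp : f p < +oo.
  rewrite ltey; apply/eqP => fp; move: far; rewrite fp gt0_muley ?lte_fin ?divr_gt0 //.
  by rewrite ltNge leey.
have [r r0 fpr] := ge0_lt_pinfty_EFin (f_ge0 p) fp.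
rewrite fpr -EFinM in far.
have [c cE] : exists c : R, dist_set d p [set y | f y = 0] = c%:E.
  by move: far far0; case: dist_set => // c _ _; exists c.
rewrite cE lee_fin in far0; rewrite cE lte_fin in far.
have rc : (r < c * m)%R by rewrite -ltr_pdivrMr // mulrC -div1r.
have c0 : (0 < c)%R by rewrite -(pmulr_lgt0 c m0); exact: le_lt_trans rc.
have rcm : (r / c < m)%R by rewrite ltr_pdivrMr // mulrC.
have rc0 : (0 <= r / c)%R by rewrite divr_ge0 // ltW.
(* The midpoint of [r / c] and [m]: [k < m] contradicts the slope bound, and [r < k * c] makes
   Ekeland's point satisfy [d p u < c], so it is not a zero. *)
pose k := ((r / c + m) / 2)%R.
have k0 : (0 < k)%R by rewrite /k; lra.
have km : (k < m)%R by rewrite /k; lra.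
have rk : (r < k * c)%R by rewrite -ltr_pdivrMr // /k; lra.
have [u pu umin] := ekeland dP f_lsc f_ge0 k0 fp.
have fu : f u <= r%:E.
  rewrite -fpr; apply: le_trans pu.
  by rewrite leeDl // lee_fin mulr_ge0 ?(cm_ge0 dP) // ltW.
have [s s0 us] := ge0_lt_pinfty_EFin (f_ge0 u) (le_lt_trans fu (ltry _)).
rewrite us lee_fin in fu; rewrite us fpr -EFinD lee_fin in pu.
have dpu : (d p u < c)%R by rewrite -(ltr_pM2l k0); lra.
have : m%:E <= strong_slope d f u.
  apply: slope.
    have := cm_triangle dP x0 p u; rewrite (cm_sym dP p x0) in far0; lra.
  rewrite us !lte_fin lt0r s0 andbT; apply/andP; split.
    apply/eqP => s00; have := dist_le u; rewrite us s00 cE lee_fin => /(_ erefl).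
    by rewrite leNgt dpu.
  rewrite ltr_pdivlMr // in p_gamma; rewrite (cm_sym dP p x0) in far0.
  have : (c * m <= d x0 p * m)%R by rewrite ler_pM2r.
  lra.
rewrite leNgt => /negP; apply; apply: (@le_lt_trans _ _ k%:E).
  apply: strong_slope_le => //; first exact: ltW.
    by rewrite us.
  by move=> v vu; apply/ltW/umin.
by rewrite lte_fin.
Qed.

End Ekeland.

(** * Completeness of the product under the sum distance *)

Lemma complete_sum_dist (R : realType) (X Z : completeNormedModType R) :
  complete_metric (@sum_dist R X Z).
Proof.
rewrite /sum_dist /norm_dist; split.
- by move=> x; rewrite !subrr !normr0 addr0.
- move=> [x q] [y r] /= /eqP; rewrite paddr_eq0 // !normr_eq0 !subr_eq0.
  by move=> /andP[/eqP-> /eqP->].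
- by move=> x y; rewrite addr_ge0.
- by move=> x y; rewrite (distrC x.1) (distrC x.2).
- move=> x y z; rewrite addrACA; apply: lerD; exact: ler_distD.
- move=> u u_cauchy.
  have cvg_comp (Y : completeNormedModType R) (g : X * Z -> Y) :
      (forall a b, `|g a - g b| <= `|a.1 - b.1| + `|a.2 - b.2|) ->
      cvg (g (u n) @[n --> \oo]).
    move=> g_le; apply: cauchy_cvg; apply: cauchy_exP => e /u_cauchy[N uN].
    exists (g (u N)); exists N => // n /uN lt_e; rewrite -ball_normE /=.
    exact: le_lt_trans lt_e.
  have c1 : cvg ((u n).1 @[n --> \oo]).
    by apply: (cvg_comp _ fst) => a b; rewrite lerDl.
  have c2 : cvg ((u n).2 @[n --> \oo]).
    by apply: (cvg_comp _ snd) => a b; rewrite lerDr.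
  exists (lim ((u n).1 @[n --> \oo]), lim ((u n).2 @[n --> \oo])) => e e0.
  have e20 : 0 < e / 2 by rewrite divr_gt0.
  near=> n; rewrite /= [ltRHS]splitr; apply: ltrD; rewrite distrC; near: n.
    by move/cvgrPdist_lt: c1; apply.
  by move/cvgrPdist_lt: c2; apply.
Unshelve. all: by end_near. Qed.

(** * The lower semicontinuous envelope and its zeros *)

Section EpigraphicalDistance.
Context {R : realType} {X Z : normedModType R}.
Variables (Q : set Z) (G : X -> set Z).
Implicit Types (p : X * Z) (z : Z).
Local Open Scope ereal_scope.

Lemma dist_set_norm_ge0 z (A : set Z) : 0 <= dist_set (@norm_dist R Z) z A.
Proof. by apply/ereal_infP => _ [a _ <-]; rewrite lee_fin normr_ge0. Qed.

Lemma phi_epi_ge0 p z : 0 <= phi_epi Q G p z.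
Proof.
rewrite /phi_epi limf_einfE.
apply: (@le_trans _ _ (ereal_inf
  [set dist_set (@norm_dist R Z) w.2 (epi_map Q G w.1) | w in setT])).
  by apply/ereal_infP => _ [w _ <-]; exact: dist_set_norm_ge0.
by apply: ereal_sup_ubound; exists setT => //; exact: filterT.
Qed.

Lemma phi_epi_le p z : phi_epi Q G p z <= dist_set (@norm_dist R Z) z (epi_map Q G p).
Proof.
rewrite /phi_epi limf_einfE; apply/ereal_supP => _ [A /nbhs_singleton Apz <-].
by apply: ereal_inf_lbound; exists (p, z).
Qed.

(** A neighbourhood of [(p, z)] with infimum above [a] has an interior containing a box, so it is
    also a neighbourhood of [(p', z)] for [p'] near [p]. *)
Lemma phi_epi_lsc z : dist_lsc (@sum_dist R X Z) (fun p => phi_epi Q G p z).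
Proof.
move=> p a; rewrite /phi_epi limf_einfE => /ereal_sup_gt[_ [A Apz <-] aA].
have [[B C] [/= Bp Cz] BCA] := nbhs_interior Apz.
have /nbhs_sum_distP[e e0 eB] := Bp.
exists e => // p' /eB Bp'; apply: (lt_le_trans aA).
rewrite limf_einfE; apply: ereal_sup_ubound; exists A => //.
by apply: (BCA (p', z)); split=> //=; exact: nbhs_singleton.
Qed.

(** A zero of the envelope only gives approximate solutions: nearby [x'], [q'] in [Q] and [g] in
    [G x'] close to [z - q]. Closedness of [Q] and of the graph passes to the limit. *)
Lemma phi_epi_eq0 (Qclosed : closed Q) (Gclosed : closed (graph G)) p z :
  phi_epi Q G p z = 0 -> epi_map Q G p z.
Proof.
case: p => x q phi0.
have close (e : R) : (0 < e)%R -> exists x' q' g, [/\ Q q', G x' g &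
    [/\ (`|x - x'| < e)%R, (`|q - q'| < e)%R & (`|z - q - g| < e)%R]].
  move=> e0; have e30 : (0 < e / 3)%R by rewrite divr_gt0.
  have : ereal_inf [set dist_set (@norm_dist R Z) w.2 (epi_map Q G w.1) |
      w in ball (x, q, z) (e / 3)] < (e / 3)%:E.
    apply: (@le_lt_trans _ _ 0); last by rewrite lte_fin.
    rewrite -phi0 /phi_epi limf_einfE; apply: ereal_sup_ubound.
    by exists (ball (x, q, z) (e / 3)%R) => //; exact: nbhsx_ballx.
  move=> /ereal_inf_lt[_ [[[x' q'] v] [[/= bx bq] bv] <-]].
  rewrite -!ball_normE /= in bx bq bv.
  move=> /ereal_inf_lt[_ [y + <-]] /=; rewrite /epi_map /= lte_fin /norm_dist.
  case: ifPn => // /set_mem Qq' [g Gg <-] vg.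
  exists x', q', g; split=> //; split; [lra|lra|].
  (* Three errors, each below [e / 3]: moving [z] to [v], the distance from [v] to [g + q'], and
     moving [q] to [q']. *)
  have -> : (z - q - g = (z - v) + (v - (g + q')) - (q - q'))%R.
    by rewrite (addrA (z - v)%R) subrK opprB opprD !addrA subrK addrAC.
  apply: le_lt_trans (ler_normB _ _) _; apply: le_lt_trans (lerD (ler_normD _ _) (lexx _)) _.
  lra.
have Qq : Q q.
  apply: Qclosed => A /nbhs_ballP[e /= /close[x' [q' [g [Qq' _ [_ bq _]]]]] eA].
  by exists q'; split=> //; apply: eA; rewrite -ball_normE.
rewrite /epi_map /= mem_set //; exists (z - q)%R; last by rewrite subrK.
apply: (Gclosed (x, z - q)%R) => A.
move=> /nbhs_ballP[e /= /close[x' [q' [g [_ Gg [bx _ bg]]]]] eA].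
by exists (x', g); split=> //; apply: eA; split; rewrite -ball_normE.
Qed.

End EpigraphicalDistance.

(** * Pseudo-openness from subregularity, and the slope criterion *)

Lemma metrically_subregular_pseudo_open (R : realType) (S T : topologicalType)
    (dS : S -> S -> R) (dT : T -> T -> R) (F : S -> set T) (x0 : S) (y0 : T) :
  metrically_subregular dS dT F x0 y0 -> linearly_pseudo_open dS dT F x0 y0.
Proof.
move=> [Fxy [L L0 [U Ux0 UL]]]; split=> //.
(* A value within [rho / L] of [y0] puts [x] at distance less than [rho] from the inverse image;
   strictness of the infimum then supplies a point of it in the ball. *)
exists L^-1, U, 1; split; rewrite ?invr_gt0 // => rho x _ [Ux [y [Fy yrho]]].
have : (dist_set dS x (mf_inv F y0) < rho%:E)%E.
  apply: le_lt_trans (UL _ Ux) _.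
  apply: (@le_lt_trans _ _ (L%:E * (dT y0 y)%:E)%E).
    by rewrite lee_pmul2l // ?lte_fin //; apply: ereal_inf_lbound; exists y.
  by rewrite -EFinM lte_fin -ltr_pdivlMl.
by move=> /ereal_inf_lt[_ [a Fa <-]]; rewrite lte_fin => xa; exists a.
Qed.

Theorem theorem4p6 (R : realType) (X Z : completeNormedModType R)
    (Q : set Z) (Qclosed : closed Q)
    (Qconvex : convex_set (Q : set (convex_lmodType Z)))
    (Qcone : pointed_cone Q)
    (G : X -> set Z) (Gclosed : closed (graph G))
    (x0 : X) (q0 z0 : Z) (Gz0 : translate (G x0) q0 z0) (Qq0 : Q q0)
    (m : R) (m_gt0 : 0 < m)
    (slope_ge : exists (U : set X) (V : set Z) (gamma : R),
      [/\ nbhs x0 U, nbhs q0 V, 0 < gamma &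
        forall (x : X) (q : Z), U x -> V q ->
          (0 < phi_epi Q G (x, q) z0 < gamma%:E)%E ->
          (m%:E <= strong_slope (@sum_dist R X Z)
                     (fun p => phi_epi Q G p z0) (x, q))%E]) :
  [/\ exists (U : set X) (V : set Z),
        [/\ nbhs x0 U, nbhs q0 V &
          forall (x : X) (q : Z), U x -> (V `&` Q) q ->
            (dist_set (@sum_dist R X Z) (x, q) (mf_inv (epi_map Q G) z0)
             <= (1 / m)%:E *
                dist_set (@norm_dist R Z) z0 (translate (G x) q))%E],
      metrically_subregular (@sum_dist R X Z) (@norm_dist R Z)
        (epi_map Q G) (x0, q0) z0 &
      linearly_pseudo_open (@sum_dist R X Z) (@norm_dist R Z)
        (epi_map Q G) (x0, q0) z0].
Proof.
have [U [V [gamma [Ux0 Vq0 gamma0 slope]]]] := slope_ge.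
pose f p := phi_epi Q G p z0.
have Ezero : epi_map Q G (x0, q0) z0 by rewrite /epi_map /= mem_set.
have f0 : f (x0, q0) = 0%E.
  apply/eqP; rewrite eq_le phi_epi_ge0 andbT; apply: le_trans (phi_epi_le _ _ _ _) _.
  apply: ereal_inf_lbound; exists z0 => //.
  by rewrite /norm_dist subrr normr0.
have /nbhs_sum_distP[delta delta0 deltaUV] : nbhs (x0, q0) (U `*` V).
  by exists (U, V).
have [e e0 bound] : exists2 e : R, 0 < e & forall p, sum_dist (x0, q0) p < e ->
    (dist_set (@sum_dist R X Z) p [set p' | f p' = 0%E] <= (1 / m)%:E * f p)%E.
  apply: (slope_error_bound (complete_sum_dist X Z) _ _ f0 m_gt0 delta0 gamma0).
  - exact: phi_epi_lsc.
  - by move=> p; exact: phi_epi_ge0.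
  - by move=> [x q] /deltaUV[/= Ux Vq]; exact: slope.
(* Stated with [epi_map], this also covers points outside [Q], where the value is empty and the
   right side is [+oo]; subregularity needs a full neighbourhood. *)
have error_bound p : sum_dist (x0, q0) p < e ->
    (dist_set (@sum_dist R X Z) p (mf_inv (epi_map Q G) z0)
     <= (1 / m)%:E * dist_set (@norm_dist R Z) z0 (epi_map Q G p))%E.
  move=> /bound pe; apply: le_trans (le_trans pe _).
    apply: ereal_inf_le_tmp => _ [p' fp' <-]; exists p' => //.
    exact: phi_epi_eq0.
  by rewrite lee_pmul2l ?lte_fin ?divr_gt0 //; exact: phi_epi_le.
have e_nbhs : nbhs (x0, q0) [set p | sum_dist (x0, q0) p < e].
  by apply/nbhs_sum_distP; exists e.
have subregular : metrically_subregular (@sum_dist R X Z) (@norm_dist R Z)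
    (epi_map Q G) (x0, q0) z0.
  split=> //; exists (1 / m); first by rewrite divr_gt0.
  by exists [set p | sum_dist (x0, q0) p < e].
split=> //; last exact: metrically_subregular_pseudo_open.
have [[U' V'] [/= U'x0 V'q0] UV'] := e_nbhs.
exists U', V'; split=> // x q Ux [Vq Qq].
have := error_bound (x, q) (UV' (x, q) (conj Ux Vq)).
by rewrite /epi_map /= mem_set.
Qed.
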